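(* Let $A$ be a normal $n\times n$ complex matrix and let $Z$ be an $n\times n$ expansive matrix, i.e. $Z^*Z\ge I$. If $f:[0,\infty)\to[0,\infty)$ is concave, then for every symmetric norm, $$\|\, f(|Z^*AZ|)\,\| \le \|\, Z^*f(|A|)Z\,\|.$$
   Context: For a matrix $X$, $|X|=(X^*X)^{1/2}$, and $f(|X|)$ is defined by the functional calculus. $Z^*Z\ge I$ is in the positive semi-definite order. A symmetric (unitarily invariant) norm is a norm on $n\times n$ matrices satisfying $\|UXV\|=\|X\|$ for all matrices $X$ and all unitaries $U,V$. *)

(* Defs.v *)
From HB Require Import structures.
From mathcomp Require Import all_boot all_order all_algebra.
From mathcomp Require Import complex.
From mathcomp Require Import reals.
Set Implicit Arguments. Unset Strict Implicit. Unset Printing Implicit Defensive.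
Import Order.TTheory GRing.Theory Num.Theory.
Local Open Scope ring_scope.
Local Open Scope complex_scope.

Section Defs.
Variable R : realType.
Local Notation C := R[i].

Definition adj {m n} (X : 'M[C]_(m, n)) : 'M[C]_(n, m) := map_mx (@Num.conj C) (X ^T).

Definition psdmx {n} (M : 'M[C]_n) : Prop :=
  adj M = M /\ forall v : 'rV[C]_n, 0 <= (v *m M *m adj v) 0 0.

Definition loewner_le {n} (X Y : 'M[C]_n) : Prop := psdmx (Y - X).

(* Functional calculus of g : R -> R on a normal matrix M with real spectrum
   (used for positive semidefinite M):  M = U^-1 diag(d) U  with U unitary
   (spectral theorem, spectralmx / spectral_diag), and
   g(M) := U^-1 diag(g(d_1), ..., g(d_n)) U. *)
Definition fcalc (g : R -> R) {n} (M : 'M[C]_n) : 'M[C]_n :=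
  invmx (spectralmx M) *m
    diag_mx (\row_i ((g (complex.Re (spectral_diag M 0 i)))%:C)) *m spectralmx M.

Definition absmx {n} (X : 'M[C]_n) : 'M[C]_n := fcalc (@Num.sqrt R) (adj X *m X).

Definition nonneg_concave_on_nonneg (f : R -> R) : Prop :=
  (forall x, 0 <= x -> 0 <= f x) /\
  (forall x y t, 0 <= x -> 0 <= y -> 0 <= t <= 1 ->
     t * f x + (1 - t) * f y <= f (t * x + (1 - t) * y)).

Definition symmetric_norm {n} (N : 'M[C]_n -> R) : Prop :=
  [/\ (forall X, 0 <= N X),
      (forall X, N X = 0 -> X = 0),
      (forall (a : C) X, (N (a *: X))%:C = `|a| * (N X)%:C),
      (forall X Y, N (X + Y) <= N X + N Y) &
      (forall X U V, U \is unitarymx -> V \is unitarymx -> N (U *m X *m V) = N X)].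

End Defs.

(* Main.v *)
Require Import Defs.
From HB Require Import structures.
From mathcomp Require Import all_boot all_order all_algebra.
From mathcomp Require Import fingroup perm.
From mathcomp Require Import complex.
From mathcomp Require Import reals.
From mathcomp Require Import ring lra.
Set Implicit Arguments. Unset Strict Implicit. Unset Printing Implicit Defensive.
Import Order.TTheory GRing.Theory Num.Theory.
Local Open Scope ring_scope.
Local Open Scope complex_scope.

(** Write [A = U^* diag(a) U] with [|a_i|] nonincreasing, and take a singular
    value decomposition [V (Z^* A Z) W^* = diag(s)] with [s] nonincreasing.
    Then [p diag(a) q = diag(s)] for the expansive matrices [p = V Z^* U^*] and
    [q = U Z W^*], and for [Y = Z^* f(|A|) Z] the diagonals of [V Y V^*] and
    [W Y W^*] average to
    [y_j = 1/2 sum_i f(|a_i|) (|p_ji|^2 + |q_ij|^2)].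

    The partial sums of [f(s_j)] are dominated by those of [y_j].  Indeed, with
    [w_i = 1/2 sum_(j < k) (|p_ji|^2 + |q_ij|^2)], compressing
    [p diag(a) q = diag(s)] to the orthogonal complement, in the first [k]
    coordinates, of the first [r] columns of [p] and taking traces gives
    [sum_(r <= j < k) s_j <= sum_(i >= r) |a_i| w_i].  Moreover [|a_j| <= s_j] by
    expansiveness and [(f(x) - f(0)) / x] is nonincreasing, so summation by parts
    gives the claim for [f - f(0)]; the constant [f(0)] is handled by
    [k <= sum_i w_i].

    Weak majorization then yields [N (diag (f s)) <= N (diag y)], and pinching
    gives [N (diag y) <= N Y]. *)

(** * Concave functions and finite sums *)

Section Scalar.
Variable R : realType.

(** A strict decrease from [x] to [y] would persist by concavity and push [f] below zero far to the
    right. *)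
Lemma nonneg_concave_nondecreasing (f : R -> R) : nonneg_concave_on_nonneg f ->
  forall x y, 0 <= x -> x <= y -> f x <= f y.
Proof.
case=> f0 fc x y x0 xy; rewrite leNgt; apply/negP => fyx.
have y0 : 0 <= y by apply: le_trans xy.
have fx : 0 < f x by apply: le_lt_trans fyx; apply: f0.
(* This weight gives [t * f x = (f x + f y) / 2]. Writing [y] as the combination of [x] and a point
   further right with weights [t] and [1 - t], concavity yields [(f x + f y) / 2 <= f y], which is
   absurd. *)
pose t := (f x + f y) / (2 * f x).
have fy := f0 _ y0.
have t0 : 0 <= t by apply: divr_ge0; lra.
have t1 : t < 1 by rewrite ltr_pdivrMr; lra.
have T0 : 0 <= (y - t * x) / (1 - t) by apply: divr_ge0; nra.
have t01 : 0 <= t <= 1 by rewrite t0 ltW.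
have := fc x ((y - t * x) / (1 - t)) t x0 T0 t01.
rewrite [(1 - t) * (_ / _)]mulrC divfK ?subr_eq0 ?gt_eqF //.
rewrite [t * x + _]addrC subrK => H.
have := f0 _ T0; set c := f (_ / _) in H * => c0.
have tf : t * f x = (f x + f y) / 2 by rewrite /t; field; rewrite gt_eqF.
have : 0 <= (1 - t) * c by apply: mulr_ge0 => //; lra.
lra.
Qed.

Lemma nonneg_concave_slope (f : R -> R) : nonneg_concave_on_nonneg f ->
  forall x y, 0 < x -> x <= y -> (f y - f 0) / y <= (f x - f 0) / x.
Proof.
case=> f0 fc x y x0 xy; have y0 : 0 < y by apply: lt_le_trans xy.
have t01 : 0 <= x / y <= 1 by apply/andP; split; [apply: divr_ge0; apply: ltW | rewrite ler_pdivrMr ?mul1r].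
have := fc y 0 (x / y) (ltW y0) (lexx 0) t01.
rewrite mulr0 addr0 divfK ?gt_eqF // => H.
rewrite ler_pdivlMr // mulrAC ler_pdivrMr //.
have e : x / y * y = x by rewrite divfK ?gt_eqF.
move: H e; set t := x / y => H e; nra.
Qed.

(* Summation by parts: a nondecreasing nonnegative [h] is a positive
   combination of indicators of final segments. *)
Lemma abel_sum_ge0 n (h c : 'I_n -> R) :
  (forall i, 0 <= h i) -> (forall i j : 'I_n, (i <= j)%N -> h i <= h j) ->
  (forall r, 0 <= \sum_(i < n | (r <= i)%N) c i) ->
  0 <= \sum_(i < n) h i * c i.
Proof.
elim: n h c => [|n IH] h c h0 hm cs; first by rewrite big_ord0.
have -> : \sum_(i < n.+1) h i * c i =
    h ord0 * \sum_(i < n.+1 | (0 <= i)%N) c i +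
    \sum_(i < n) (h (lift ord0 i) - h ord0) * c (lift ord0 i).
  rewrite !big_ord_recl /= mulrDr mulr_sumr -addrA -big_split /=.
  by congr (_ + _); apply: eq_bigr => i _; ring.
apply: addr_ge0; first by apply: mulr_ge0.
apply: IH => [i|i j ij|r]; first by rewrite subr_ge0 hm.
  by apply: lerB => //; apply: hm; rewrite !lift0.
have := cs r.+1; rewrite big_mkcond big_ord_recl /= add0r.
by rewrite [X in _ -> 0 <= X]big_mkcond.
Qed.

(** Since [s] is nonincreasing, the cheapest way to place mass at least [k - r] on the first [k]
    coordinates, at most 1 on each, is to fill the positions from [r] to [k - 1]. *)
Lemma weighted_sum_ge_tail n (s c : 'I_n -> R) (r k : nat) : (k <= n)%N ->
  (forall i j : 'I_n, (i <= j)%N -> s j <= s i) -> (forall i, 0 <= s i) ->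
  (forall i, 0 <= c i <= 1) -> (forall i : 'I_n, (k <= i)%N -> c i = 0) ->
  (k - r)%:R <= \sum_i c i ->
  \sum_(j < n | (r <= j < k)%N) s j <= \sum_j s j * c j.
Proof.
move=> kn sm s0 c01 ck cs.
have [kr|rk] := leqP k r.
  rewrite big_pred0; first by apply: sumr_ge0 => i _; rewrite mulr_ge0 //; case/andP: (c01 i).
  by move=> j; apply/negP => /andP[a b]; have := leq_ltn_trans a b; rewrite ltnNge kr.
have rn := leq_trans rk kn.
pose o := Ordinal rn.
pose d (j : 'I_n) : R := ((r <= j < k)%N)%:R.
have ds : \sum_j d j = (k - r)%:R.
  rewrite /d -(big_mkord xpredT (fun j => ((r <= j < k)%N)%:R)) /=.
  rewrite (@big_cat_nat _ _ _ r) //=; last exact: ltnW.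
  rewrite (@big_cat_nat _ _ _ k r n) //=; last exact: ltnW.
  rewrite big_nat_cond big1 ?add0r; last first.
    by move=> i /andP[/andP[_ ir] _]; rewrite leqNgt ir.
  rewrite [X in _ + X]big_nat_cond [X in _ + X]big1 ?addr0; last first.
    by move=> i /andP[/andP[ki _] _]; rewrite [(i < k)%N]ltnNge ki andbF.
  rewrite big_nat_cond (eq_bigr (fun=> 1)); last by move=> i /andP[-> _].
  by rewrite -big_nat_cond sumr_const_nat.
have -> : \sum_(j < n | (r <= j < k)%N) s j = \sum_j s j * d j.
  rewrite big_mkcond; apply: eq_bigr => j _; rewrite /d.
  by case: (_ && _); rewrite ?mulr1 ?mulr0.
(* With pivot [s_r], every term is nonnegative: both factors change sign at [r], and [c] and [d]
   vanish from [k] on. *)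
have H : 0 <= \sum_j (s j - s o) * (c j - d j).
  apply: sumr_ge0 => j _; rewrite /d.
  have /andP[c0 c1] := c01 j.
  have [rj|jr] := leqP r j; rewrite /=.
    have sj : s j <= s o by apply: sm.
    have [jk|kj] := ltnP j k; first by rewrite /=; nra.
    by rewrite ck //= subr0 mulr0.
  have sj : s o <= s j by apply: sm; apply: ltnW.
  by rewrite subr0; nra.
have -> : \sum_j s j * c j = \sum_j s j * d j +
   (\sum_j (s j - s o) * (c j - d j) + s o * (\sum_j c j - \sum_j d j)).
  rewrite mulrBr !mulr_sumr -sumrB -!big_split /=.
  by apply: eq_bigr => j _; ring.
rewrite lerDl addr_ge0 // mulr_ge0 // ds subr_ge0 //.
Qed.

Lemma concave_weighted_prefix n (k : nat) (a s w : 'I_n -> R) (f : R -> R) :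
  nonneg_concave_on_nonneg f ->
  (forall i, 0 <= a i) -> (forall i j : 'I_n, (i <= j)%N -> a j <= a i) ->
  (forall i, 0 <= s i) -> (forall i, a i <= s i) -> (forall i, 0 <= w i) ->
  (forall r, \sum_(j < n | (r <= j < k)%N) s j <=
             \sum_(i < n | (r <= i)%N) a i * w i) ->
  \sum_(j < n | (j < k)%N) 1 <= \sum_i w i ->
  \sum_(j < n | (j < k)%N) f (s j) <= \sum_i f (a i) * w i.
Proof.
move=> fc a0 am s0 as_ w0 tail wk.
have fmono := nonneg_concave_nondecreasing fc.
have slope := nonneg_concave_slope fc.
have f00 : 0 <= f 0 by case: fc => + _; apply.
pose g x := f x - f 0.
have g0 x : 0 <= x -> 0 <= g x by move=> x0; rewrite subr_ge0; apply: fmono.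
have q0 i : 0 <= g (a i) / a i by apply: divr_ge0 => //; apply: g0.
(* Any upper bound on the slopes would do: as [a] is nonincreasing, its zeros come last, and the
   value [M] there keeps [h] nondecreasing. *)
pose M := \sum_i g (a i) / a i.
pose h i := if a i == 0 then M else g (a i) / a i.
have gM i : g (a i) / a i <= M.
  by rewrite /M (bigD1 i) //= lerDl; apply: sumr_ge0.
have h0 i : 0 <= h i by rewrite /h; case: ifP => _ //; apply: sumr_ge0.
have hm (i j : 'I_n) : (i <= j)%N -> h i <= h j.
  move=> ij; have := am _ _ ij; rewrite /h.
  have [->|aj] := eqVneq (a j) 0; first by case: ifP.
  move=> aji; have aj0 : 0 < a j by rewrite lt_def aj a0.
  by rewrite gt_eqF ?(lt_le_trans aj0) //; apply: slope.
pose c (i : 'I_n) := a i * w i - (if (i < k)%N then s i else 0).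
have sumc r : \sum_(i < n | (r <= i)%N) c i =
    \sum_(i < n | (r <= i)%N) a i * w i - \sum_(j < n | (r <= j < k)%N) s j.
  by rewrite /c sumrB [in RHS]big_mkcondr.
have /(abel_sum_ge0 h0 hm) : forall r, 0 <= \sum_(i < n | (r <= i)%N) c i.
  by move=> r; rewrite sumc subr_ge0.
have -> : \sum_i h i * c i =
    \sum_i g (a i) * w i - \sum_(j < n | (j < k)%N) h j * s j.
  rewrite [X in _ - X]big_mkcond -sumrB; apply: eq_bigr => i _.
  rewrite /c /h mulrBr; congr (_ - _); last by case: (i < k)%N; rewrite ?mulr0.
  have [->|ai] := eqVneq (a i) 0; first by rewrite /g subrr !mul0r mulr0.
  by rewrite mulrA divfK.
rewrite subr_ge0 => H.
have gs : \sum_(j < n | (j < k)%N) g (s j) <= \sum_(j < n | (j < k)%N) h j * s j.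
  apply: ler_sum => j jk; rewrite /h; case: eqVneq => [aj|aj]; last first.
    have aj0 : 0 < a j by rewrite lt_def aj a0.
    have sj0 := lt_le_trans aj0 (as_ j).
    by rewrite -ler_pdivrMr //; apply: slope.
  (* When [a_j = 0], all later [a_i] vanish too, so the tail hypothesis at [r = j] forces
     [s_j = 0]. *)
  suff -> : s j = 0 by rewrite /g subrr mulr0.
  apply/eqP; rewrite eq_le s0 andbT.
  have := tail j; rewrite [X in _ <= X]big1; last first.
    move=> i ji; suff -> : a i = 0 by rewrite mul0r.
    by apply/eqP; rewrite eq_le a0 andbT -aj am.
  rewrite (bigD1 j) ?leqnn //=; apply: le_trans.
  by rewrite lerDl; apply: sumr_ge0.
have -> : \sum_i f (a i) * w i = f 0 * (\sum_i w i) + \sum_i g (a i) * w i.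
  by rewrite mulr_sumr -big_split; apply: eq_bigr => i _ /=; rewrite /g; ring.
have -> : \sum_(j < n | (j < k)%N) f (s j) =
    f 0 * \sum_(j < n | (j < k)%N) 1 + \sum_(j < n | (j < k)%N) g (s j).
  by rewrite mulr_sumr -big_split; apply: eq_bigr => i _ /=; rewrite /g; ring.
by apply: lerD; [apply: ler_wpM2l | apply: le_trans H].
Qed.

Lemma exists_sorting_perm n (x : 'I_n -> R) :
  exists s : 'S_n, forall i j : 'I_n, (i <= j)%N -> x (s j) <= x (s i).
Proof.
pose e : rel 'I_n := fun i j => x j <= x i.
have et : total e by move=> i j; apply: le_total.
have etr : transitive e by move=> j i k; rewrite /e => a b; apply: le_trans b a.
pose l := sort e (enum 'I_n).
have sl : size l = n by rewrite size_sort size_enum_ord.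
have ul : uniq l by rewrite sort_uniq enum_uniq.
have inj : injective (fun i : 'I_n => nth i l i).
  move=> i j /eqP.
  rewrite (set_nth_default i) ?sl // nth_uniq ?sl // => /eqP H; exact: val_inj.
exists (perm inj) => i j ij; rewrite !permE.
rewrite (set_nth_default i) ?sl //.
move: ij; rewrite leq_eqVlt => /orP[/eqP/val_inj->|ij] //.
apply: (sorted_leq_nth etr (fun z => lexx (x z)) i (sort_sorted et _)) => //;
  rewrite ?inE ?sl //; exact: ltnW.
Qed.

End Scalar.

(** * Symmetric norms: weak majorization and pinching *)

Section Gauge.
Variables (R : realType) (n : nat) (Phi : 'rV[R]_n -> R).

Definition flip_coord (l : 'I_n) (x : 'rV[R]_n) : 'rV[R]_n :=
  \row_i (if i == l then - x 0 i else x 0 i).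

Hypothesis Phi_convex : forall t x y, 0 <= t <= 1 ->
  Phi (t *: x + (1 - t) *: y) <= t * Phi x + (1 - t) * Phi y.
Hypothesis Phi_flip : forall l x, Phi (flip_coord l x) = Phi x.
Hypothesis Phi_xcol : forall i j x, Phi (xcol i j x) = Phi x.

(** One coordinate is lowered at a time: since [0 <= x_l < y_l], the lowered vector lies on the
    segment from [y] to its reflection in coordinate [l]. *)
Lemma gauge_mono (x y : 'rV[R]_n) :
  (forall i, 0 <= x 0 i) -> (forall i, x 0 i <= y 0 i) -> Phi x <= Phi y.
Proof.
move=> x0; have [m] := ubnP #|[pred l | x 0 l != y 0 l]|.
elim: m y => // m IH y mm xy.
have [l /= xyl|H] := pickP [pred l | x 0 l != y 0 l]; last first.
  suff -> : x = y by [].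
  by apply/rowP => i; have /negbFE/eqP := H i.
have lxy : x 0 l < y 0 l by rewrite lt_neqAle xyl xy.
have y0 : 0 < y 0 l by apply: le_lt_trans lxy.
pose y' : 'rV[R]_n := \row_i (if i == l then x 0 l else y 0 i).
apply: (@le_trans _ _ (Phi y')).
  apply: IH => [|i]; last by rewrite mxE; case: eqP => [->|].
  rewrite -ltnS; apply: leq_trans mm; rewrite ltnS.
  apply: proper_card; apply/properP; split.
    apply/subsetP => i; rewrite !inE mxE; case: (eqVneq i l) => [->|//].
    by rewrite eqxx.
  by exists l => //; rewrite !inE mxE !eqxx.
(* Solution of [t * y_l - (1 - t) * y_l = x_l]. *)
pose t := (1 + x 0 l / y 0 l) / 2.
have q1 : x 0 l / y 0 l <= 1 by rewrite ler_pdivrMr // mul1r ltW.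
have q0 : 0 <= x 0 l / y 0 l by rewrite divr_ge0 // ltW.
have -> : y' = t *: y + (1 - t) *: flip_coord l y.
  apply/rowP => i; rewrite !mxE; case: eqP => [->|_]; last by ring.
  by rewrite /t; field; rewrite gt_eqF.
have t01 : 0 <= t <= 1 by rewrite /t; apply/andP; split; lra.
apply: le_trans (Phi_convex _ _ t01) _; rewrite Phi_flip; lra.
Qed.

(* Hardy-Littlewood-Polya: each step moves mass [d] from a coordinate where
   [y] exceeds [x] to a later one where it falls short; the result lies
   between [y] and a transposition of [y]. *)
Lemma gauge_weak_majorization (x y : 'rV[R]_n) :
  (forall i, 0 <= x 0 i) ->
  (forall i j : 'I_n, (i <= j)%N -> x 0 j <= x 0 i) ->
  (forall k, \sum_(j < n | (j < k)%N) x 0 j <= \sum_(j < n | (j < k)%N) y 0 j) ->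
  Phi x <= Phi y.
Proof.
move=> x0 xm; have [m] := ubnP #|[pred l | x 0 l != y 0 l]|.
elim: m y => // m IH y mm pre.
have [j0 xyj0|H] := pickP [pred l | y 0 l < x 0 l]; last first.
  by apply: gauge_mono => // i; rewrite leNgt; have /= -> := H i.
(* Let [j] be the first coordinate where [y] falls short; the prefix sum through [j] then forces an
   earlier [i] with [x_i < y_i]. *)
case: (arg_minnP (fun j : 'I_n => nat_of_ord j) xyj0) => j /= xyj jmin.
have xyl (l : 'I_n) : (l < j)%N -> x 0 l <= y 0 l.
  by move=> lj; rewrite leNgt; apply/negP => /jmin; rewrite leqNgt lj.
have [i /andP[ij xyi]|H] := pickP [pred i : 'I_n | (i < j)%N && (x 0 i < y 0 i)]; last first.
  have := pre j.+1; rewrite (bigD1 j) //= [X in _ <= X](bigD1 j) //=.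
  rewrite [X in _ + X <= _](eq_bigr (fun l => y 0 l)); first by rewrite lerD2r leNgt xyj.
  move=> l /andP[]; rewrite ltnS leq_eqVlt => /orP[/eqP/val_inj->|lj _]; first by rewrite eqxx.
  apply/eqP; rewrite eq_le xyl //= leNgt; apply/negP => xl.
  by have := H l; rewrite /= lj xl.
have xij : x 0 j <= x 0 i by apply: xm; apply: ltnW.
(* The largest transfer that overshoots neither [x_i] nor [x_j]; it makes one of the two coordinates
   agree with [x], so the induction measure drops. *)
pose d := Num.min (y 0 i - x 0 i) (x 0 j - y 0 j).
have d0 : 0 < d by rewrite lt_min !subr_gt0 xyi xyj.
have di : d <= y 0 i - x 0 i by rewrite ge_min lexx.
have dj : d <= x 0 j - y 0 j by rewrite ge_min lexx orbT.
have nij : i != j by apply/eqP => e; move: ij; rewrite e ltnn.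
pose y' : 'rV[R]_n :=
  \row_l (if l == i then y 0 i - d else if l == j then y 0 j + d else y 0 l).
have y'i : y' 0 i = y 0 i - d by rewrite mxE eqxx.
have y'j : y' 0 j = y 0 j + d by rewrite mxE eq_sym (negbTE nij) eqxx.
have y'l l : l != i -> l != j -> y' 0 l = y 0 l.
  by move=> li lj; rewrite mxE (negbTE li) (negbTE lj).
apply: (@le_trans _ _ (Phi y')).
  apply: IH => [|k].
    rewrite -ltnS; apply: leq_trans mm; rewrite ltnS.
    apply: proper_card; apply/properP; split.
      apply/subsetP => l; rewrite !inE.
      have [->|li] := eqVneq l i; first by move=> _; rewrite lt_eqF.
      have [->|lj] := eqVneq l j; first by move=> _; rewrite gt_eqF.
      by rewrite y'l.
    have [dd|dd] : d = y 0 i - x 0 i \/ d = x 0 j - y 0 j.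
      by rewrite /d; case: leP; [left|right].
    - exists i; rewrite !inE; first by rewrite lt_eqF.
      by rewrite y'i dd subKr eqxx.
    - exists j; rewrite !inE; first by rewrite gt_eqF.
      by rewrite y'j dd addrC subrK eqxx.
  (* Prefixes stopping before [i] are unchanged, those containing [i] but not [j] are dominated term
     by term by minimality of [j], and those containing both keep their sum. *)
  have [ki|ik] := leqP k i.
    rewrite [X in _ <= X](eq_bigr (fun l => y 0 l)) ?pre // => l lk.
    rewrite y'l //; apply/eqP => e; move: lk; rewrite e ltnNge; first by rewrite ki.
    by rewrite (leq_trans ki) // ltnW.
  have [kj|jk] := leqP k j.
    apply: ler_sum => l lk; have lj := leq_trans lk kj.
    have [->|li] := eqVneq l i; first by rewrite y'i; lra.
    rewrite y'l ?xyl //; apply/eqP => e; move: lj; by rewrite e ltnn.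
  apply: le_trans (pre k) _.
  rewrite (bigD1 i) //= [X in _ <= X](bigD1 i) //= (bigD1 j) /=; last by rewrite jk eq_sym.
  rewrite [X in _ <= _ + X](bigD1 j) /=; last by rewrite jk eq_sym.
  rewrite y'i y'j [X in _ <= _ + (_ + X)](eq_bigr (fun l => y 0 l)).
    set S := \sum_(_ < _ | _) _; lra.
  by move=> l /andP[/andP[_ li] lj]; rewrite y'l.
(* Chosen so that [(1 - t) * (y_i - y_j) = d]. *)
pose t := 1 - d / (y 0 i - y 0 j).
have yij : 0 < y 0 i - y 0 j by lra.
have -> : y' = t *: y + (1 - t) *: xcol i j y.
  apply/rowP => l; rewrite ![in RHS]mxE.
  have [->|li] := eqVneq l i.
    by rewrite y'i tpermL /t; field; rewrite gt_eqF.
  have [->|lj] := eqVneq l j.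
    by rewrite y'j tpermR /t; field; rewrite gt_eqF.
  by rewrite y'l // tpermD 1?eq_sym //; ring.
have t01 : 0 <= t <= 1.
  rewrite /t; have : 0 <= d / (y 0 i - y 0 j) by rewrite divr_ge0 ?ltW.
  have : d / (y 0 i - y 0 j) <= 1 by rewrite ler_pdivrMr // mul1r; lra.
  by move=> *; apply/andP; split; lra.
apply: le_trans (Phi_convex _ _ t01) _; rewrite Phi_xcol; lra.
Qed.

End Gauge.

Section SymmetricNorm.
Variables (R : realType) (n : nat) (N : 'M[R[i]]_n -> R).
Hypothesis N_sym : symmetric_norm N.
Local Notation C := R[i].

Definition realdiag (x : 'rV[R]_n) : 'M[C]_n := diag_mx (\row_i (x 0 i)%:C).

Lemma symmetric_norm_scale (t : R) X : 0 <= t -> N (t%:C *: X) = t * N X.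
Proof.
case: N_sym => _ _ Nz _ _ t0; have := Nz t%:C X.
by rewrite ger0_norm ?ler0c // -rmorphM => /complexI.
Qed.

Lemma symmetric_norm_convex (t : R) X Y : 0 <= t <= 1 ->
  N (t%:C *: X + (1 - t)%:C *: Y) <= t * N X + (1 - t) * N Y.
Proof.
case: (N_sym) => _ _ _ Nd _ /andP[t0 t1]; apply: le_trans (Nd _ _) _.
by rewrite !symmetric_norm_scale ?subr_ge0.
Qed.

Definition flipmx (l : 'I_n) : 'M[C]_n := diag_mx (\row_i (if i == l then -1 else 1)).

Lemma flipmx_unitary l : flipmx l \is unitarymx.
Proof.
apply/unitarymxP/matrixP => i j; rewrite tr_diag_mx map_diag_mx mul_diag_mx !mxE.
case: (eqVneq i j) => [->|_]; last by rewrite mulr0n mulr0.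
by case: ifP => _; rewrite ?mulr1n ?rmorphN ?rmorph1 ?mulrNN mulr1.
Qed.

Lemma symmetric_norm_flip l X : N (flipmx l *m X *m flipmx l) = N X.
Proof. by case: N_sym => _ _ _ _; apply; apply: flipmx_unitary. Qed.

Lemma flipmx_conjE l (X : 'M[C]_n) i j : (flipmx l *m X *m flipmx l) i j =
  (if i == l then -1 else 1) * X i j * (if j == l then -1 else 1).
Proof. by rewrite mul_mx_diag mul_diag_mx !mxE. Qed.

Lemma perm_mx_unitary (s : 'S_n) : (perm_mx s : 'M[C]_n) \is unitarymx.
Proof.
apply/unitarymxP; rewrite tr_perm_mx map_perm_mx -perm_mxM mulgV.
exact: perm_mx1.
Qed.

(** The off-diagonal entries are removed one row and column at a time, each removal being the
    average of a matrix and its conjugate by a diagonal sign matrix. *)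
Lemma pinching_le (X : 'M[C]_n) : N (diag_mx (\row_i X i i)) <= N X.
Proof.
(* The diagonal together with the block of indices at least [m]: this interpolates between [X] at
   [m = 0] and its diagonal at [m = n]. *)
pose pinch (m : nat) : 'M[C]_n := \matrix_(i, j)
  (if (i == j) || ((m <= i) && (m <= j))%N then X i j else 0).
have -> : diag_mx (\row_i X i i) = pinch n.
  apply/matrixP => i j; rewrite !mxE [(n <= i)%N]leqNgt ltn_ord orbF.
  by case: eqVneq => [->|].
have -> : N X = N (pinch 0%N) by congr N; apply/matrixP => i j; rewrite mxE orbT.
have H m : (m <= n)%N -> N (pinch m) <= N (pinch 0%N).
  elim: m => // m IH mn; apply: le_trans (IH (ltnW mn)).
  pose l := Ordinal mn.
  have h : 0 <= (2^-1 : R) <= 1 by apply/andP; split; lra.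
  have -> : pinch m.+1 = (2^-1)%:C *: pinch m +
      (1 - 2^-1)%:C *: (flipmx l *m pinch m *m flipmx l).
    apply/matrixP => i j; rewrite [RHS]mxE [X in _ = X + _]mxE [X in _ = _ + X]mxE flipmx_conjE.
    have e : (2^-1)%:C + (1 - 2^-1)%:C = 1 :> C by rewrite -rmorphD addrC subrK.
    have e' : (2^-1)%:C = (1 - 2^-1)%:C :> C by congr _%:C; field.
    rewrite !mxE !(leq_eqVlt m) -!(eq_sym l) -!val_eqE /=.
    have [->|ij] := eqVneq i j; first by rewrite eqxx /=; case: ifP => _; rewrite ?mulrN1 ?mulN1r ?opprK ?mulr1 ?mul1r -mulrDl e mul1r.
    move: ij; rewrite -val_eqE /= => /negbTE ij; rewrite ij /=.
    case: (eqVneq m i) => mi; case: (eqVneq m j) => mj /=.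
    - by move: ij; rewrite -mi -mj eqxx.
    - rewrite -mi ltnn /=; case: ifP => _; last by rewrite !(mulr0, mul0r, addr0).
      by rewrite mulr1 mulN1r mulrN e' subrr.
    - rewrite -mj ltnn andbF andbT; case: ifP => _; last by rewrite !(mulr0, mul0r, addr0).
      by rewrite mul1r mulrN1 mulrN e' subrr.
    - by rewrite mulr1 mul1r -mulrDl e mul1r.
  apply: le_trans (symmetric_norm_convex _ _ h) _.
  rewrite symmetric_norm_flip; lra.
exact: H.
Qed.

Lemma symmetric_norm_weak_majorization (x y : 'rV[R]_n) :
  (forall i, 0 <= x 0 i) ->
  (forall i j : 'I_n, (i <= j)%N -> x 0 j <= x 0 i) ->
  (forall k, \sum_(j < n | (j < k)%N) x 0 j <= \sum_(j < n | (j < k)%N) y 0 j) ->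
  N (realdiag x) <= N (realdiag y).
Proof.
apply: (@gauge_weak_majorization _ _ (fun x => N (realdiag x))) => [t u v t01|l u|i j u].
- apply: le_trans (symmetric_norm_convex _ _ t01).
  rewrite -!linearZ -linearD le_eqVlt; apply/orP; left; apply/eqP; congr (N (diag_mx _)).
  by apply/rowP => i; rewrite !mxE rmorphD !rmorphM.
(* A sign change is a left multiplication by a unitary; below, a transposition is a conjugation by a
   permutation matrix. *)
- have [_ _ _ _ Nu] := N_sym.
  rewrite -(Nu (realdiag u) (flipmx l) 1%:M) ?flipmx_unitary //; last first.
    by apply/unitarymxP; rewrite trmx1 map_mx1 mulmx1.
  congr N; apply/matrixP => i j; rewrite mulmx1 mul_diag_mx !mxE.
  case: (eqVneq i j) => [->|_]; last by rewrite !mulr0n mulr0.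
  by case: ifP => _; rewrite !mulr1n ?mulN1r ?mul1r // rmorphN.
- have [_ _ _ _ Nu] := N_sym.
  rewrite -(Nu (realdiag u) (perm_mx (tperm i j)) (perm_mx (tperm i j)^-1)) ?perm_mx_unitary //.
  congr N; rewrite -row_permE -col_permE; apply/matrixP => a b; rewrite !mxE.
  by rewrite (inj_eq perm_inj).
Qed.

End SymmetricNorm.

(** * Expansive matrices and singular values *)

Section Matrices.
Variable R : realType.
Local Notation C := R[i].

(** Valued in [R] rather than [C], so that estimates take place in a totally ordered field. *)
Definition sqn (z : C) : R := complex.Re z ^+ 2 + complex.Im z ^+ 2.

Definition cabs (z : C) : R := Num.sqrt (sqn z).

Lemma sqn_ge0 z : 0 <= sqn z. Proof. by rewrite addr_ge0 ?sqr_ge0. Qed.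

Lemma sqnE z : (sqn z)%:C = z * Num.conj z.
Proof. by rewrite /sqn add_Re2_Im2 normCK. Qed.

Lemma sqnM y z : sqn (y * z) = sqn y * sqn z.
Proof. by apply: complexI; rewrite rmorphM /= !sqnE rmorphM /= mulrACA. Qed.

Lemma sqn_conj z : sqn (Num.conj z) = sqn z.
Proof. by apply: complexI; rewrite !sqnE conjCK mulrC. Qed.

Lemma sqn_real (x : R) : sqn x%:C = x ^+ 2.
Proof. by rewrite /sqn /= expr0n addr0. Qed.

Lemma sqn_eq0 z : (sqn z == 0) = (z == 0).
Proof. by rewrite -(inj_eq (@complexI R)) sqnE mul_conjC_eq0. Qed.

Lemma normE_cabs z : `|z| = (cabs z)%:C.
Proof. exact: normc_def. Qed.

Lemma cabs_ge0 z : 0 <= cabs z. Proof. exact: sqrtr_ge0. Qed.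

Lemma sqr_cabs z : cabs z ^+ 2 = sqn z.
Proof. by rewrite sqr_sqrtr ?sqn_ge0. Qed.

Lemma adjM m n p (X : 'M[C]_(m, n)) (Y : 'M[C]_(n, p)) :
  adj (X *m Y) = adj Y *m adj X.
Proof. by rewrite /adj trmx_mul map_mxM. Qed.

Lemma adjK m n (X : 'M[C]_(m, n)) : adj (adj X) = X.
Proof. by apply/matrixP => i j; rewrite !mxE conjCK. Qed.

Lemma adjB m n (X Y : 'M[C]_(m, n)) : adj (X - Y) = adj X - adj Y.
Proof. by apply/matrixP => i j; rewrite !mxE rmorphB. Qed.

Lemma adj_realdiag n (x : 'rV[R]_n) : adj (realdiag x) = realdiag x.
Proof.
apply/matrixP => i j; rewrite !mxE eq_sym.
case: eqVneq => [->|_]; last by rewrite !mulr0n rmorph0.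
by rewrite !mulr1n; exact: conjc_real.
Qed.

Lemma adj_diag_mulmx n (a : 'rV[C]_n) :
  adj (diag_mx a) *m diag_mx a = realdiag (\row_i sqn (a 0 i)).
Proof.
rewrite /adj tr_diag_mx map_diag_mx mulmx_diag; congr diag_mx.
by apply/rowP => i; rewrite !mxE sqnE mulrC.
Qed.

Lemma mul_adj_unitary m n (U : 'M[C]_(m, n)) : U \is unitarymx -> U *m adj U = 1%:M.
Proof. by move/unitarymxP. Qed.

Lemma adj_mul_unitary n (U : 'M[C]_n) : U \is unitarymx -> adj U *m U = 1%:M.
Proof. by move/mul_adj_unitary/mulmx1C. Qed.

Lemma adj_unitary n (U : 'M[C]_n) : (adj U \is unitarymx) = (U \is unitarymx).
Proof. exact: trmxC_unitary. Qed.

Definition rsq n (v : 'rV[C]_n) : R := \sum_j sqn (v 0 j).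

Lemma rsq_ge0 n (v : 'rV[C]_n) : 0 <= rsq v.
Proof. by apply: sumr_ge0 => j _; apply: sqn_ge0. Qed.

Lemma rsq_eq0 n (v : 'rV[C]_n) : rsq v = 0 -> v = 0.
Proof.
move=> H; apply/rowP => j; apply/eqP; rewrite mxE -sqn_eq0; apply/eqP.
by apply: (psumr_eq0P _ H) => // i _; apply: sqn_ge0.
Qed.

Lemma rsqE n (v : 'rV[C]_n) : (v *m adj v) 0 0 = (rsq v)%:C.
Proof.
rewrite mxE /rsq (raddf_sum (real_complex R)).
by apply: eq_bigr => j _ /=; rewrite !mxE sqnE.
Qed.

Lemma rsq_mul_unitary n (v : 'rV[C]_n) (U : 'M[C]_n) :
  U \is unitarymx -> rsq (v *m U) = rsq v.
Proof.
by move=> uU; apply: complexI; rewrite -!rsqE adjM mulmxA -(mulmxA v) mul_adj_unitary ?mulmx1.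
Qed.

Lemma rsq_delta n (j : 'I_n) : rsq (delta_mx 0 j) = 1.
Proof.
rewrite /rsq (bigD1 j) //= mxE !eqxx big1 ?addr0 => [|i ij].
  by rewrite /sqn /= expr1n expr0n addr0.
by rewrite mxE (negbTE ij) andbF; apply/eqP; rewrite sqn_eq0.
Qed.

(** The difference of the two sides is the squared norm of [x - x G^* G], the component of [x]
    orthogonal to the rows of [G]. *)
Lemma bessel m n (G : 'M[C]_(m, n)) (x : 'rV[C]_n) :
  G \is unitarymx -> rsq (x *m adj G) <= rsq x.
Proof.
move=> uG; rewrite -subr_ge0; apply: le_trans (rsq_ge0 (x - x *m adj G *m G)) _.
rewrite le_eqVlt; apply/orP; left; apply/eqP/complexI.
rewrite rmorphB /= -!rsqE !adjM adjK adjB !adjM adjK.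
rewrite mulmxBr !mulmxBl.
rewrite -!(mulmxA _ G (adj G *m _)) (mulmxA G (adj G)) mul_adj_unitary // mul1mx.
by rewrite !mulmxA subrr subr0 !mxE.
Qed.

(** Rows act from the left, so this means [X X^* >= I]; the hypothesis [Z^* Z >= I] is therefore
    expansiveness of [adj Z]. *)
Definition expansive m n (X : 'M[C]_(m, n)) := forall v : 'rV_m, rsq v <= rsq (v *m X).

Lemma expansiveM m n p (X : 'M[C]_(m, n)) (Y : 'M[C]_(n, p)) :
  expansive X -> expansive Y -> expansive (X *m Y).
Proof. by move=> eX eY v; rewrite mulmxA; apply: le_trans (eY _). Qed.

Lemma unitary_expansive n (U : 'M[C]_n) : U \is unitarymx -> expansive U.
Proof. by move=> uU v; rewrite rsq_mul_unitary. Qed.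

Lemma expansive_unit n (X : 'M[C]_n) : expansive X -> X \in unitmx.
Proof.
move=> eX; rewrite unitmxE unitfE; apply/det0P => -[v v0 vX].
have := eX v; rewrite vX {2}/rsq big1 => [|j _]; last first.
  by apply/eqP; rewrite sqn_eq0 mxE.
by move=> H; case/eqP: v0; apply: rsq_eq0; apply/eqP; rewrite eq_le H rsq_ge0.
Qed.

(* With [y = x X], expanding [0 <= |y X^* - x|^2] gives
   [2 |y|^2 <= |y X^*|^2 + |x|^2], and [|x| <= |y|]. *)
Lemma expansive_adj n (X : 'M[C]_n) : expansive X -> expansive (adj X).
Proof.
move=> eX y; have uX := expansive_unit eX.
pose x := y *m invmx X; have xX : x *m X = y by rewrite mulmxKV.
have xy : rsq x <= rsq y by rewrite -xX.
have H : rsq (y *m adj X - x) = rsq (y *m adj X) - rsq y - rsq y + rsq x.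
  apply: complexI; rewrite rmorphD !rmorphB /= -!rsqE.
  rewrite adjB mulmxBr !mulmxBl.
  have e1 : y *m adj X *m adj x = y *m adj y by rewrite -mulmxA -adjM xX.
  have e2 : x *m adj (y *m adj X) = y *m adj y by rewrite adjM adjK mulmxA xX.
  by rewrite e1 e2 !mxE; ring.
have := rsq_ge0 (y *m adj X - x); rewrite H; lra.
Qed.

Lemma loewner_expansive n (Z : 'M[C]_n) :
  loewner_le 1%:M (adj Z *m Z) -> expansive (adj Z).
Proof.
case=> _ H v; rewrite -lecR -!rsqE -subr_ge0.
by have := H v; rewrite mulmxBr mulmxBl mulmx1 adjM adjK !mulmxA !mxE.
Qed.

Lemma rsq_mul_diag n (v a : 'rV[C]_n) :
  rsq (v *m diag_mx a) = \sum_i sqn (v 0 i) * sqn (a 0 i).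
Proof. by apply: eq_bigr => i _; rewrite mul_mx_diag mxE sqnM. Qed.

(* Min-max comparison: there is a nonzero [v] supported on the coordinates
   [>= j] with [v p] supported on the coordinates [<= j]. *)
Lemma singular_value_ge n (p q : 'M[C]_n) (a : 'rV[C]_n) (s : 'rV[R]_n) :
  expansive p -> expansive q -> p *m diag_mx a *m q = realdiag s ->
  (forall i j : 'I_n, (i <= j)%N -> cabs (a 0 j) <= cabs (a 0 i)) ->
  (forall i j : 'I_n, (i <= j)%N -> s 0 j <= s 0 i) ->
  (forall i, 0 <= s 0 i) ->
  forall j, cabs (a 0 j) <= s 0 j.
Proof.
move=> ep eq pq am sm s0 j.
(* A left null vector of [M] satisfies both support conditions: columns before [j] read off its
   coordinates, columns after [j] are those of [p], and the zero column [j] makes [M] singular. *)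
pose M : 'M[C]_n := \matrix_(i, c)
  (if (c < j)%N then (i == c)%:R else if c == j then 0 else p i c).
have : \det M == 0.
  rewrite (expand_det_col _ j) big1 // => i _.
  by rewrite mxE ltnn eqxx mul0r.
move=> /det0P[v v0 vM].
have v_lt (c : 'I_n) : (c < j)%N -> v 0 c = 0.
  move=> cj; have /rowP/(_ c) := vM; rewrite !mxE => <-.
  rewrite (bigD1 c) //= mxE cj eqxx mulr1 big1 ?addr0 // => i ic.
  by rewrite mxE cj (negbTE ic) mulr0.
have v_gt (c : 'I_n) : (j < c)%N -> (v *m p) 0 c = 0.
  move=> jc; have /rowP/(_ c) := vM; rewrite !mxE => vMc; rewrite -[RHS]vMc.
  apply: eq_bigr => i _; rewrite mxE ltnNge (ltnW jc) /=.
  by case: eqP => // e; move: jc; rewrite e ltnn.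
have vp : 0 < rsq v.
  rewrite lt_def rsq_ge0 andbT; apply/eqP => /rsq_eq0 e.
  by move/eqP: v0.
have le1 : rsq (v *m realdiag s) <= s 0 j ^+ 2 * rsq v.
  rewrite rsq_mul_diag mulr_sumr; apply: ler_sum => i _.
  rewrite !mxE sqn_real mulrC; have [ij|ji] := ltnP i j.
    have -> : sqn (v 0 i) = 0 by apply/eqP; rewrite sqn_eq0 v_lt.
    by rewrite !mulr0.
  by apply: ler_wpM2r; [exact: sqn_ge0 | apply: lerXn2r; rewrite ?nnegrE ?sm].
have le2 : sqn (a 0 j) * rsq (v *m p) <= rsq (v *m p *m diag_mx a).
  rewrite rsq_mul_diag mulr_sumr; apply: ler_sum => i _.
  rewrite mulrC; have [ji|ij] := ltnP j i.
    have -> : sqn ((v *m p) 0 i) = 0 by apply/eqP; rewrite sqn_eq0 v_gt.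
    by rewrite !mul0r.
  apply: ler_wpM2l; [exact: sqn_ge0 | rewrite -!sqr_cabs].
  by apply: lerXn2r; rewrite ?nnegrE ?cabs_ge0 ?am.
(* Chain: [|a_j|^2 |v|^2 <= |a_j|^2 |v p|^2 <= |v p diag(a)|^2 <= |v p diag(a) q|^2 = |v diag(s)|^2
   <= s_j^2 |v|^2]. *)
have : sqn (a 0 j) * rsq v <= s 0 j ^+ 2 * rsq v.
  apply: le_trans le1; rewrite -pq !mulmxA; apply: le_trans (eq _).
  by apply: le_trans le2; apply: ler_wpM2l; [exact: sqn_ge0 | exact: ep].
rewrite ler_pM2r // => H.
by rewrite -(ger0_norm (s0 j)) -sqrtr_sqr ler_wsqrtr.
Qed.

(* The rows of [G] are an orthonormal basis of the vectors supported on the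
   first [k] coordinates that are killed by the first [r] columns of [p]. *)
Lemma exists_annihilator n (p : 'M[C]_n) (r k : nat) : (k <= n)%N ->
  exists m, exists G : 'M[C]_(m, n), [/\ G \is unitarymx, (k - r <= m)%N,
    (forall l (j : 'I_n), (k <= j)%N -> G l j = 0) &
    (forall l (i : 'I_n), (i < r)%N -> (G *m p) l i = 0)].
Proof.
move=> kn.
pose A1 := kermx (p *m pid_mx r : 'M[C]_n).
pose A2 := kermx (copid_mx k : 'M[C]_n).
pose B := (A1 :&: A2)%MS.
have B_free := row_base_free B.
have GB : (schmidt (row_base B) <= B)%MS.
  by rewrite eqmx_schmidt_free // eq_row_base.
exists (\rank B), (schmidt (row_base B)); split.
- by apply: schmidt_unitarymx; apply: rank_leq_col.
(* Dimension count: [A1] has dimension at least [n - r], [A2] has dimension [k], and their sum has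
   dimension at most [n]. *)
- have := mxrank_sum_cap A1 A2; rewrite !mxrank_ker rank_copid_mx // -/B.
  have := rank_leq_col (A1 + A2)%MS.
  have : (\rank (p *m pid_mx r : 'M[C]_n) <= minn n r)%N.
    apply: leq_trans (mxrankM_maxr _ _) _.
    have [rn|nr] := leqP r n; first by rewrite rank_pid_mx.
    exact: rank_leq_row.
  rewrite (subKn kn) leq_min => /andP[pn pr] sn e.
  rewrite leq_subLR -(leq_add2l n) (addnCA n).
  rewrite (leq_trans _ (leq_add (leqnn r) (leq_add sn (leqnn (\rank B))))) //.
  by rewrite e addnA leq_add2r -leq_subLR leq_sub2l.
- move=> l j kj; move: (submx_trans GB (capmxSr A1 A2)) => /sub_kermxP/matrixP/(_ l j).
  have -> : copid_mx k = diag_mx (\row_(j < n) ((k <= j)%N)%:R) :> 'M[C]_n.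
    apply/matrixP => x y; rewrite !mxE -!val_eqE; case: eqP => [/= ->|_].
      by rewrite ltnNge; case: (k <= y)%N; rewrite /= ?subrr ?subr0.
    by rewrite /= subr0 !mulr0n.
  by rewrite mul_mx_diag !mxE kj mulr1.
- move=> l i ir; move: (submx_trans GB (capmxSl A1 A2)) => /sub_kermxP/matrixP/(_ l i).
  have -> : pid_mx r = diag_mx (\row_(j < n) ((j < r)%N)%:R) :> 'M[C]_n.
    apply/matrixP => x y; rewrite !mxE -val_eqE.
    by case: eqP => [->|_]; rewrite /= ?mulr1n ?mulr0n.
  by rewrite mulmxA mul_mx_diag [LHS]mxE !mxE ir mulr1.
Qed.

Definition prefix_weight n (p q : 'M[C]_n) (k : nat) (i : 'I_n) : R :=
  2^-1 * \sum_(j < n | (j < k)%N) (sqn (p j i) + sqn (q i j)).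

Lemma prefix_weight_ge0 n (p q : 'M[C]_n) k i : 0 <= prefix_weight p q k i.
Proof.
rewrite mulr_ge0 ?invr_ge0 ?ler0n //; apply: sumr_ge0 => j _.
by rewrite addr_ge0 ?sqn_ge0.
Qed.

Lemma singular_tail_le n (p q : 'M[C]_n) (a : 'rV[C]_n) (s : 'rV[R]_n) k r :
  (k <= n)%N -> p *m diag_mx a *m q = realdiag s ->
  (forall i j : 'I_n, (i <= j)%N -> s 0 j <= s 0 i) ->
  (forall i, 0 <= s 0 i) ->
  \sum_(j < n | (r <= j < k)%N) s 0 j <=
  \sum_(i < n | (r <= i)%N) cabs (a 0 i) * prefix_weight p q k i.
Proof.
move=> kn pq sm s0; have [m [G [uG km Gk Gp]]] := exists_annihilator p r kn.
(* The trace of [G diag(s) G^*] is the sum of the [s_j c_j]. These weights lie in [[0, 1]], vanish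
   from [k] on and sum to [m >= k - r], as [weighted_sum_ge_tail] requires. *)
pose c j := \sum_l sqn (G l j).
have GG : \sum_j c j = m%:R.
  rewrite /c exchange_big /= (eq_bigr (fun=> 1)) ?sumr_const ?card_ord // => l _.
  apply: complexI; have /matrixP/(_ l l) := mul_adj_unitary uG.
  rewrite !mxE eqxx mulr1n rmorph1 => <-; rewrite (raddf_sum (real_complex R)).
  by apply: eq_bigr => j _ /=; rewrite !mxE sqnE.
have cE j : c j = rsq (delta_mx 0 j *m adj G).
  by apply: eq_bigr => l _; rewrite -rowE !mxE sqn_conj.
have le_s : \sum_(j < n | (r <= j < k)%N) s 0 j <= \sum_j s 0 j * c j.
  apply: weighted_sum_ge_tail => // [j|j kj|].
  - by rewrite cE rsq_ge0 -[X in _ <= X](rsq_delta j) bessel.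
  - by rewrite /c big1 // => l _; apply/eqP; rewrite sqn_eq0 Gk.
  - by rewrite GG ler_nat.
apply: le_trans le_s _.
pose Gq := q *m adj G.
have trE : (\sum_j s 0 j * c j)%:C = \sum_i \sum_l (G *m p) l i * a 0 i * Gq i l.
  transitivity (\tr (G *m realdiag s *m adj G)).
    rewrite /mxtrace (eq_bigr (fun l => \sum_j (s 0 j)%:C * (sqn (G l j))%:C)).
      rewrite exchange_big (raddf_sum (real_complex R)) /=; apply: eq_bigr => j _.
      by rewrite rmorphM /= /c (raddf_sum (real_complex R)) mulr_sumr.
    move=> l _; rewrite mxE; apply: eq_bigr => j _.
    by rewrite mul_mx_diag !mxE sqnE; ring.
  rewrite -pq !mulmxA -(mulmxA _ q) /mxtrace exchange_big /=.
  apply: eq_bigr => l _; rewrite mxE; apply: eq_bigr => i _.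
  by rewrite mul_mx_diag [X in X * _]mxE.
(* Truncating column [i] of [p] to its first [k] entries leaves its product with [G] unchanged,
   because [G] vanishes on the other coordinates; Bessel then applies to the truncation. *)
have GpB i : \sum_l sqn ((G *m p) l i) <= \sum_(j < n | (j < k)%N) sqn (p j i).
  pose x : 'rV[C]_n := \row_j (if (j < k)%N then Num.conj (p j i) else 0).
  have -> : \sum_(j < n | (j < k)%N) sqn (p j i) = rsq x.
    rewrite big_mkcond; apply: eq_bigr => j _; rewrite mxE.
    by case: ifP => _; [rewrite sqn_conj | apply/esym/eqP; rewrite sqn_eq0].
  apply: le_trans (bessel x uG); apply: ler_sum => l _.
  suff -> : (x *m adj G) 0 l = Num.conj ((G *m p) l i) by rewrite sqn_conj.
  rewrite !mxE rmorph_sum; apply: eq_bigr => j _; rewrite !mxE rmorphM /= mulrC.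
  by case: ltnP => [//|kj]; rewrite (Gk _ _ kj) rmorph0 !mul0r.
have GqB i : \sum_l sqn (Gq i l) <= \sum_(j < n | (j < k)%N) sqn (q i j).
  pose x : 'rV[C]_n := \row_j (if (j < k)%N then q i j else 0).
  have -> : \sum_(j < n | (j < k)%N) sqn (q i j) = rsq x.
    rewrite big_mkcond; apply: eq_bigr => j _; rewrite mxE.
    by case: ifP => _; last by apply/esym/eqP; rewrite sqn_eq0.
  apply: le_trans (bessel x uG); apply: ler_sum => l _.
  suff -> : Gq i l = (x *m adj G) 0 l by [].
  rewrite !mxE; apply: eq_bigr => j _; rewrite !mxE.
  by case: ltnP => [//|kj]; rewrite (Gk _ _ kj) rmorph0 !mulr0.
rewrite -lecR; apply: (@le_trans _ _ `|(\sum_j s 0 j * c j)%:C|).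
  by apply: real_ler_norm; rewrite complex_real.
rewrite trE; apply: le_trans (ler_norm_sum _ _ _) _.
rewrite (raddf_sum (real_complex R)) [X in _ <= X]big_mkcond /=.
apply: ler_sum => i _; have [ri|ir] := leqP r i; last first.
  by rewrite big1 ?normr0 // => l _; rewrite Gp // !mul0r.
apply: le_trans (ler_norm_sum _ _ _) _.
have -> : \sum_l `|(G *m p) l i * a 0 i * Gq i l| =
    (cabs (a 0 i) * \sum_l cabs ((G *m p) l i) * cabs (Gq i l))%:C.
  rewrite mulr_sumr (raddf_sum (real_complex R)); apply: eq_bigr => l _ /=.
  by rewrite !normrM !normE_cabs -!rmorphM /=; congr _%:C; ring.
rewrite lecR; apply: ler_wpM2l; first exact: cabs_ge0.
rewrite /prefix_weight big_split /=.
apply: le_trans (ler_wpM2l _ (lerD (GpB i) (GqB i))); last by rewrite invr_ge0 ler0n.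
rewrite -big_split mulr_sumr; apply: ler_sum => l _ /=; rewrite -!sqr_cabs.
(* Arithmetic-geometric mean, the source of the factor [1/2] in [prefix_weight]. *)
move: (cabs _) (cabs _) => x y; have := sqr_ge0 (x - y); rewrite sqrrB; lra.
Qed.

(** Every row of [p] and every column of [q] has norm at least 1, the columns being handled through
    [expansive_adj]. *)
Lemma prefix_weight_sum n (p q : 'M[C]_n) k : expansive p -> expansive q ->
  \sum_(j < n | (j < k)%N) 1 <= \sum_i prefix_weight p q k i.
Proof.
move=> ep eq; rewrite -mulr_sumr exchange_big /= mulr_sumr; apply: ler_sum => j _.
rewrite big_split /=.
have h1 : 1 <= \sum_i sqn (p j i).
  have := ep (delta_mx 0 j); rewrite rsq_delta -rowE => /le_trans; apply.
  by apply: ler_sum => i _; rewrite mxE.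
have h2 : 1 <= \sum_i sqn (q i j).
  have := expansive_adj eq (delta_mx 0 j); rewrite rsq_delta -rowE => /le_trans; apply.
  by apply: ler_sum => i _; rewrite !mxE sqn_conj.
lra.
Qed.

Lemma prefix_sum_le n (p q : 'M[C]_n) (a : 'rV[C]_n) (s : 'rV[R]_n) (f : R -> R) :
  nonneg_concave_on_nonneg f ->
  expansive p -> expansive q -> p *m diag_mx a *m q = realdiag s ->
  (forall i j : 'I_n, (i <= j)%N -> cabs (a 0 j) <= cabs (a 0 i)) ->
  (forall i j : 'I_n, (i <= j)%N -> s 0 j <= s 0 i) ->
  (forall i, 0 <= s 0 i) ->
  forall k, \sum_(j < n | (j < k)%N) f (s 0 j) <=
    \sum_(j < n | (j < k)%N)
      2^-1 * \sum_i f (cabs (a 0 i)) * (sqn (p j i) + sqn (q i j)).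
Proof.
move=> fc ep eq pq am sm s0 k.
wlog kn : k / (k <= n)%N.
  move=> H; have [|nk] := leqP k n; first exact: H.
  have e (F : 'I_n -> R) : \sum_(j < n | (j < k)%N) F j = \sum_(j < n | (j < n)%N) F j.
    by apply: eq_bigl => j; rewrite ltn_ord (ltn_trans _ nk).
  by rewrite !e; apply: H.
have -> : \sum_(j < n | (j < k)%N)
      2^-1 * \sum_i f (cabs (a 0 i)) * (sqn (p j i) + sqn (q i j)) =
    \sum_i f (cabs (a 0 i)) * prefix_weight p q k i.
  rewrite -mulr_sumr exchange_big mulr_sumr; apply: eq_bigr => i _ /=.
  by rewrite -mulr_sumr /prefix_weight; ring.
apply: concave_weighted_prefix => // [i|i|i|r|].
- exact: cabs_ge0.
- exact: (singular_value_ge ep eq pq).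
- exact: prefix_weight_ge0.
- exact: singular_tail_le.
- exact: prefix_weight_sum.
Qed.

End Matrices.

(** * Functional calculus and singular value decomposition *)

Section Spectral.
Variable R : realType.
Local Notation C := R[i].

Lemma unitary_diag_normal n (U : 'M[C]_n) (a : 'rV[C]_n) :
  U \is unitarymx -> adj U *m diag_mx a *m U \is normalmx.
Proof.
move=> uU; have /esym e := invmx_unitary uU; rewrite -/(adj U) in e.
rewrite e; apply/orthomx_spectral_subproof; by exists (U, a).
Qed.

(** Functional calculus does not depend on the diagonalization: [W = S U^*] intertwines the two
    diagonals, so [W_ij <> 0] forces [e_i = d_j], and [W] still intertwines them after [g] is
    applied. *)
Lemma unitary_diag_map (g : R -> R) n (S U : 'M[C]_n) (e : 'rV[C]_n) (d : 'rV[R]_n) :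
  S \is unitarymx -> U \is unitarymx ->
  adj U *m realdiag d *m U = adj S *m diag_mx e *m S ->
  adj S *m diag_mx (\row_i (g (complex.Re (e 0 i)))%:C) *m S =
  adj U *m realdiag (map_mx g d) *m U.
Proof.
move=> uS uU ME.
have [W WE] : exists W, W = S *m adj U by exists (S *m adj U).
have WU : S = W *m U by rewrite WE -mulmxA adj_mul_unitary // mulmx1.
have UW : adj U = adj S *m W by rewrite WE mulmxA adj_mul_unitary // mul1mx.
have We : diag_mx e *m W = W *m realdiag d.
  have := congr1 (fun X => S *m X *m adj U) ME.
  rewrite !mulmxA -WE mul_adj_unitary // mul1mx -!mulmxA mul_adj_unitary // mulmx1.
  by rewrite -WE.
have Wg : diag_mx (\row_i (g (complex.Re (e 0 i)))%:C) *m W = W *m realdiag (map_mx g d).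
  apply/matrixP => i j; have /matrixP/(_ i j) := We.
  rewrite !mul_diag_mx !mul_mx_diag !mxE.
  have [->|Wij] := eqVneq (W i j) 0; first by rewrite !mulr0 !mul0r.
  by rewrite [RHS]mulrC => /(mulIf Wij) ->; rewrite /= mulrC.
by rewrite [X in _ *m X = _]WU UW mulmxA -[adj S *m _ *m W]mulmxA Wg mulmxA.
Qed.

Lemma fcalc_unitary_diag n (g : R -> R) (U : 'M[C]_n) (d : 'rV[R]_n) :
  U \is unitarymx ->
  fcalc g (adj U *m realdiag d *m U) = adj U *m realdiag (map_mx g d) *m U.
Proof.
move=> uU; rewrite /fcalc invmx_unitary ?spectral_unitarymx // -/(adj _).
apply: (unitary_diag_map g (spectral_unitarymx _) uU).
have /orthomx_spectralP := unitary_diag_normal (\row_i (d 0 i)%:C) uU.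
by rewrite invmx_unitary ?spectral_unitarymx.
Qed.

(** The key is a parameter because [A] is sorted by modulus, whereas the Gram matrix in [exists_svd]
    is sorted by real part. *)
Lemma normal_sorted_diag n (A : 'M[C]_n) (key : C -> R) : A \is normalmx ->
  exists U : 'M[C]_n, exists a : 'rV[C]_n,
  [/\ U \is unitarymx, A = adj U *m diag_mx a *m U &
      forall i j : 'I_n, (i <= j)%N -> key (a 0 j) <= key (a 0 i)].
Proof.
move=> /orthomx_spectralP; set S := spectralmx A; set e := spectral_diag A.
have uS : S \is unitarymx := spectral_unitarymx A.
rewrite invmx_unitary // -/(adj S) => AE.
have [s sP] := exists_sorting_perm (fun i => key (e 0 i)).
have uP := perm_mx_unitary R s.
exists (perm_mx s *m S), (\row_i e 0 (s i)); split.
- exact: mul_unitarymx.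
- have H : diag_mx (\row_i e 0 (s i)) *m perm_mx s = perm_mx s *m diag_mx e.
    apply/matrixP => i j; rewrite mul_diag_mx mul_mx_diag !mxE.
    by case: eqVneq => [->|_]; rewrite ?mulr0 ?mul0r ?mulr1 ?mul1r.
  rewrite adjM -!mulmxA (mulmxA (diag_mx _)) H -mulmxA (mulmxA (adj (perm_mx s))).
  by rewrite adj_mul_unitary // mul1mx mulmxA.
- by move=> i j ij; rewrite !mxE sP.
Qed.

(** Induction on rows: once the rows before [i] are diagonal, orthogonality of row [i] to row [l]
    reads [L_il s_l = 0]. *)
Lemma triangular_gram_diag n (L : 'M[C]_n) (s : 'rV[R]_n) :
  (forall i j : 'I_n, (i < j)%N -> L i j = 0) -> (forall i, 0 <= L i i) ->
  (forall i j : 'I_n, (i <= j)%N -> s 0 j <= s 0 i) -> (forall i, 0 <= s 0 i) ->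
  L *m adj L = realdiag (\row_i (s 0 i ^+ 2)) -> L = realdiag s.
Proof.
move=> Lt L0 sm s0 LL; apply/matrixP => i.
have [m] := ubnP i; elim: m i => // m IH i im j.
have IHs (l : 'I_n) : (l < i)%N -> forall c, L l c = realdiag s l c.
  by move=> li; apply: IH; apply: leq_trans li _.
have LLii : \sum_c sqn (L i c) = s 0 i ^+ 2.
  apply: complexI; have /matrixP/(_ i i) := LL; rewrite !mxE eqxx mulr1n => <-.
  rewrite (raddf_sum (real_complex R)); apply: eq_bigr => c _ /=.
  by rewrite !mxE sqnE.
have Llt (l : 'I_n) : l != i -> L i l = 0.
  move=> li; have [il|il] := ltnP i l; first exact: Lt.
  have {}li : (l < i)%N by rewrite ltn_neqAle il andbT.
  (* If [s_i = 0], the whole row vanishes; otherwise [s_l >= s_i > 0] can be cancelled. *)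
  have [si|si] := eqVneq (s 0 i) 0.
    apply/eqP; rewrite -sqn_eq0; apply/eqP.
    apply: (psumr_eq0P (P := xpredT) (F := fun c => sqn (L i c))) => // [c _|].
      exact: sqn_ge0.
    by rewrite LLii si expr0n.
  have sl : 0 < s 0 l.
    by apply: lt_le_trans (sm _ _ il); rewrite lt_def si s0.
  have /matrixP/(_ i l) := LL; rewrite !mxE [in RHS]eq_sym.
  rewrite -val_eqE /= ltn_eqF // mulr0n (bigD1 l) //= big1 => [|c cl].
    rewrite addr0 !mxE (IHs _ li) !mxE eqxx mulr1n => /eqP.
    rewrite mulf_eq0 conjC_eq0 => /orP[/eqP //|/eqP/complexI sl0].
    by move: sl; rewrite sl0 ltxx.
  by rewrite !mxE (IHs _ li) !mxE eq_sym (negbTE cl) mulr0n rmorph0 mulr0.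
rewrite !mxE; have [<-|ji] := eqVneq i j; last by rewrite Llt 1?eq_sym // mulr0n.
rewrite mulr1n; move: LLii; rewrite (bigD1 i) //= big1 => [|c ci]; last first.
  by apply/eqP; rewrite sqn_eq0 Llt.
rewrite addr0; have := L0 i; case: (L i i) => x y.
rewrite lecE /= => /andP[/eqP -> x0]; rewrite sqn_real => /eqP.
by rewrite eqrXn2 // => /eqP ->.
Qed.

(* Gram-Schmidt applied to the orthogonal rows of [W H^*] yields the left
   singular vectors: the triangular change of basis has orthogonal rows. *)
Lemma exists_svd n (H : 'M[C]_n) :
  exists V : 'M[C]_n, exists W : 'M[C]_n, exists s : 'rV[R]_n,
  [/\ V \is unitarymx, W \is unitarymx, V *m H *m adj W = realdiag s,
      (forall i j : 'I_n, (i <= j)%N -> s 0 j <= s 0 i) & forall i, 0 <= s 0 i].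
Proof.
have nH : adj H *m H \is normalmx.
  by apply/normalmxP; rewrite -/(adj (adj H *m H)) adjM adjK.
have [W [e [uW HE em]]] := normal_sorted_diag (@complex.Re R) nH.
pose B := W *m adj H.
have BB : B *m adj B = diag_mx e.
  rewrite adjM adjK mulmxA -(mulmxA W) HE !mulmxA mul_adj_unitary // mul1mx.
  by rewrite -mulmxA mul_adj_unitary // mulmx1.
have eE i : e 0 i = (rsq (row i B))%:C.
  have /matrixP/(_ i i) := BB; rewrite !mxE eqxx mulr1n => <-.
  rewrite (raddf_sum (real_complex R)); apply: eq_bigr => c _ /=.
  by rewrite !mxE sqnE.
pose s : 'rV[R]_n := \row_i Num.sqrt (rsq (row i B)).
have sm (i j : 'I_n) : (i <= j)%N -> s 0 j <= s 0 i.
  by move=> /em; rewrite !eE /= !mxE; apply: ler_wsqrtr.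
have s0 i : 0 <= s 0 i by rewrite mxE sqrtr_ge0.
pose V := schmidt B; have uV : V \is unitarymx by apply: schmidt_unitarymx.
have LE : B *m adj V = realdiag s.
  apply: triangular_gram_diag => // [i j ij|i|].
  (* Row [i] of [B] lies in the span of the rows of [V] up to [i], all orthogonal to row [j > i]. *)
  - have : (row i B <= kermx (adj (row j V)))%MS.
      apply: submx_trans (row_schmidt_sub B i) _; apply/sumsmx_subP => k ki.
      rewrite genmxE; apply/sub_kermxP/rowP => z; rewrite ord1.
      have /matrixP/(_ k j) := mul_adj_unitary uV.
      rewrite !mxE -val_eqE /= ltn_eqF ?(leq_ltn_trans ki) // mulr0n => e0; rewrite -[RHS]e0.
      by apply: eq_bigr => c _; rewrite !mxE.
    move=> /sub_kermxP/rowP/(_ 0); rewrite !mxE => e0; rewrite -[RHS]e0.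
    by apply: eq_bigr => c _; rewrite !mxE.
  - have := form1_row_schmidt B i; rewrite dotmxE !mxE.
    by under eq_bigr do rewrite !mxE; under [X in _ -> _ <= X]eq_bigr do rewrite !mxE.
  - rewrite adjM adjK mulmxA -(mulmxA B) adj_mul_unitary // mulmx1 BB.
    congr diag_mx; apply/rowP => i; rewrite !mxE eE sqr_sqrtr //; exact: rsq_ge0.
exists V, W, s; split => //.
by rewrite -(adj_realdiag s) -LE !adjM !adjK mulmxA.
Qed.

Lemma absmx_unitary_diag n (U : 'M[C]_n) (a : 'rV[C]_n) : U \is unitarymx ->
  absmx (adj U *m diag_mx a *m U) = adj U *m realdiag (map_mx (@cabs R) a) *m U.
Proof.
move=> uU; rewrite /absmx !adjM adjK !mulmxA -(mulmxA _ U) mul_adj_unitary // mulmx1.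
rewrite -(mulmxA _ _ (diag_mx a)) adj_diag_mulmx fcalc_unitary_diag //.
by congr (_ *m realdiag _ *m _); apply/rowP => i; rewrite !mxE.
Qed.

Lemma absmx_svd n (V W : 'M[C]_n) (s : 'rV[R]_n) :
  V \is unitarymx -> W \is unitarymx -> (forall i, 0 <= s 0 i) ->
  absmx (adj V *m realdiag s *m W) = adj W *m realdiag s *m W.
Proof.
move=> uV uW s0; rewrite /absmx !adjM adjK !mulmxA -(mulmxA _ V) mul_adj_unitary //.
rewrite mulmx1 -(mulmxA _ _ (realdiag s)) adj_diag_mulmx fcalc_unitary_diag //.
congr (_ *m realdiag _ *m _); apply/rowP => i.
by rewrite !mxE sqn_real sqrtr_sqr ger0_norm.
Qed.

Lemma diag_congr_realdiag n (p : 'M[C]_n) (x : 'rV[R]_n) :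
  diag_mx (\row_j (p *m realdiag x *m adj p) j j) =
  realdiag (\row_j \sum_i x 0 i * sqn (p j i)).
Proof.
congr diag_mx; apply/rowP => j; rewrite !mxE (raddf_sum (real_complex R)).
apply: eq_bigr => i _ /=; rewrite mul_mx_diag !mxE rmorphM /= sqnE; ring.
Qed.

End Spectral.

(** * Combining majorization with pinching *)

Theorem theorem3p1 (R : realType) (n : nat) (A Z : 'M[R[i]]_n) (f : R -> R)
  (N : 'M[R[i]]_n -> R) :
  A \is normalmx ->
  loewner_le 1%:M (adj Z *m Z) ->
  nonneg_concave_on_nonneg f ->
  symmetric_norm N ->
  N (fcalc f (absmx (adj Z *m A *m Z))) <= N (adj Z *m fcalc f (absmx A) *m Z).
Proof.
move=> nA /loewner_expansive eZ fc Ns.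
have eZ' := expansive_adj eZ; rewrite adjK in eZ'.
have [U [a [uU AE am]]] := normal_sorted_diag (@cabs R) nA.
have [V [W [s [uV uW HE sm s0]]]] := exists_svd (adj Z *m A *m Z).
have [_ _ _ _ Nu] := Ns.
pose p := V *m adj Z *m adj U; pose q := U *m Z *m adj W.
have ep : expansive p.
  apply: (expansiveM (expansiveM (unitary_expansive uV) eZ)).
  by apply: unitary_expansive; rewrite adj_unitary.
have eq : expansive q.
  apply: (expansiveM (expansiveM (unitary_expansive uU) eZ')).
  by apply: unitary_expansive; rewrite adj_unitary.
have pq : p *m diag_mx a *m q = realdiag s by rewrite -HE AE /p /q !mulmxA.
have {HE}HE : adj Z *m A *m Z = adj V *m realdiag s *m W.
  rewrite -HE !mulmxA adj_mul_unitary // mul1mx -!mulmxA.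
  by rewrite adj_mul_unitary // mulmx1.
rewrite HE absmx_svd // {1}AE absmx_unitary_diag // !fcalc_unitary_diag //.
set x := map_mx f s; set b := map_mx f _; set Y := adj Z *m _ *m Z.
rewrite Nu ?adj_unitary //.
(* With [b = f(|a|)], [V Y V^*] is [p diag(b) p^*] and [W Y W^*] is [q^* diag(b) q]; [y1] and [y2]
   are their diagonals. *)
pose y1 : 'rV[R]_n := \row_j \sum_i b 0 i * sqn (p j i).
pose y2 : 'rV[R]_n := \row_j \sum_i b 0 i * sqn (adj q j i).
have Ny1 : N (realdiag y1) <= N Y.
  rewrite -diag_congr_realdiag; apply: le_trans (pinching_le Ns _) _.
  rewrite -(Nu Y V (adj V)) ?adj_unitary // /p /Y !adjM !adjK !mulmxA //.
have Ny2 : N (realdiag y2) <= N Y.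
  rewrite -diag_congr_realdiag; apply: le_trans (pinching_le Ns _) _.
  rewrite -(Nu Y W (adj W)) ?adj_unitary // /q /Y !adjM !adjK !mulmxA //.
have h : 0 <= (2^-1 : R) <= 1 by apply/andP; split; lra.
apply: (@le_trans _ _ (N (realdiag (2^-1 *: y1 + (1 - 2^-1) *: y2)))).
  apply: symmetric_norm_weak_majorization => // [i|i j ij|k].
  - by rewrite mxE; apply: fc.1.
  - by rewrite !mxE; apply: nonneg_concave_nondecreasing (sm _ _ ij).
  - rewrite (eq_bigr (fun j => f (s 0 j))); last by move=> j _; rewrite mxE.
    apply: le_trans (prefix_sum_le fc ep eq pq am sm s0 k) _.
    apply: ler_sum => j _; rewrite !mxE.
    have -> : 1 - 2^-1 = 2^-1 :> R by field.
    rewrite -mulrDr -big_split ler_wpM2l ?invr_ge0 ?ler0n //.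
    by apply: ler_sum => i _; rewrite !mxE /= sqn_conj mulrDr.
apply: (@le_trans _ _ (2^-1 * N (realdiag y1) + (1 - 2^-1) * N (realdiag y2))); last lra.
apply: le_trans (symmetric_norm_convex Ns _ _ h).
rewrite le_eqVlt; apply/orP; left; apply/eqP; congr N.
rewrite -!linearZ -linearD; congr diag_mx.
by apply/rowP => i; rewrite !mxE rmorphD !rmorphM.
Qed.
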